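(* Let $\mathcal{M}$ be a normal $S3^\forall_\equiv$-model and $\le_\mathcal{M}$ its preorder. The following are equivalent: (i) $\mathcal{M}$ is a Boolean algebra and satisfies the Collapse Axiom; (ii) $\mathcal{M}$ is a Boolean algebra with $\mathit{NEC}=\{f_\top\}$; (iii) $\le_\mathcal{M}$ is a partial order; (iv) strict equivalence coincides with propositional identity, i.e., $\mathcal{M}\vDash\forall x\forall y((x\equiv y)\leftrightarrow(\square(x\rightarrow y)\wedge\square(y\rightarrow x)))$.
   Context: Language: $Fm(C)$ is the set of formulas built from propositional variables $V$, a set $C$ of propositional constants containing $\top,\bot$, connectives $\neg,\rightarrow,\vee,\wedge$, identity connective $\equiv$, necessity $\square$ and universal propositional quantifier $\forall$. The Collapse Axiom is the scheme $(\square\varphi\wedge\square\psi)\rightarrow(\varphi\equiv\psi)$ (''there is only one necessary proposition''). Semantics: a propositional domain is $\mathcal{M}=(M,\mathit{TRUE},\mathit{NEC},f_\bot,f_\top,f_\square,f_\neg,f_\vee,f_\wedge,f_\rightarrow,f_\equiv,f_\forall,\varGamma)$ with $\mathit{TRUE},\mathit{NEC}\subseteq M$, operations of obvious arities, $f_\forall\colon M^M\to M$, $\varGamma\colon C\to M$ with $\varGamma(\bot)=f_\bot,\varGamma(\top)=f_\top$; assignments $\gamma\colon V\to M$ extend homomorphically with $\gamma(c)=\varGamma(c)$ and $\gamma(\forall x\varphi)=f_\forall(m\mapsto\gamma_x^m(\varphi))$. $t\colon M\to M$ is $(\varphi,x,\gamma)$-definable if $t(m)=\gamma_x^m(\varphi)$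 for all $m$ (definable if so for some $\varphi,x,\gamma$). With $a\le_\mathcal{M}b:\Leftrightarrow f_\rightarrow(a,b)\in\mathit{NEC}$ and $\approx_\mathcal{M}$ its symmetric part, $\mathcal{M}$ is an $S3^\forall_\equiv$-model if: (1) when $\mathit{NEC}\neq\varnothing$, $\le_\mathcal{M}$ is a preorder making $(M,f_\bot,f_\top,f_\neg,f_\vee,f_\wedge,f_\rightarrow,\le_\mathcal{M})$ a Boolean prealgebra (i.e. $\approx_\mathcal{M}$ is a congruence and the quotient is a Boolean algebra with order induced by $\le_\mathcal{M}$ and induced operations as bottom, top, complement, join, meet, implication); (2) $f_\bot\notin\mathit{TRUE}$, $f_\top\in\mathit{TRUE}$, classical truth conditions for $f_\rightarrow,f_\neg,f_\wedge,f_\vee$, $f_\square(a)\in\mathit{TRUE}\Leftrightarrow a\in\mathit{NEC}$, $f_\equiv(a,b)\in\mathit{TRUE}\Leftrightarrow a=b$, $f_\forall(t)\in\mathit{TRUE}$ for definable $t$ with image in $\mathit{TRUE}$; (3) when $\mathit{NEC}\neq\varnothing$, $\mathit{NEC}\subseteq\mathit{TRUE}$ is upward closed under $\le_\mathcal{M}$ and closed under $f_\wedge$; (4) when $\mathit{NEC}\neq\varnothing$: $f_\top\le_\mathcal{M}f_\equiv(a,a)$; $f_\equiv(a,b)\le_\mathcal{M}f_\rightarrow(a,b)$; $f_\equiv(a,b)\le_\mathcal{M}f_\equiv(t(a),t(b))$ for definable $t$; $f_\square(a)\le_\mathcal{M}a$; $f_\square(f_\rightarrow(a,b))\le_\mathcal{M}f_\rightarrow(f_\square(a),f_\square(b))$;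 $f_\square(f_\rightarrow(a,b))\le_\mathcal{M}f_\square(f_\rightarrow(f_\square(a),f_\square(b)))$; $f_\forall(t)\le_\mathcal{M}f_\equiv(f_\forall(t_1),f_\forall(t_2))$ and $f_\forall(t)\le_\mathcal{M}f_\rightarrow(f_\forall(t_1),f_\forall(t_2))$ for $t_1,t_2$ $(\varphi,x,\gamma)$-, $(\psi,x,\gamma)$-definable and $t$ the pointwise $f_\equiv$, resp. $f_\rightarrow$, of $t_1,t_2$; $f_\forall(t)\le_\mathcal{M}t(a)$ for definable $t$; $f_\forall(t)\le_\mathcal{M}f_\rightarrow(b,f_\forall(t'))$ for $t'$ $(\psi,x,\gamma)$-definable, $b$ the denotation of a sentence and $t(a)=f_\rightarrow(b,t'(a))$; $f_\square(f_\forall(t))\approx_\mathcal{M}f_\forall(a\mapsto f_\square(t(a)))$ for definable $t$; $f_\forall(t)\in\mathit{NEC}$ for definable $t$ with image in $\mathit{NEC}$. It is normal if $\mathit{NEC}\neq\varnothing$. $(\mathcal{M},\gamma)\vDash\varphi:\Leftrightarrow\gamma(\varphi)\in\mathit{TRUE}$; $\mathcal{M}\vDash\varphi$ means true under all assignments; $\mathcal{M}$ satisfies the Collapse Axiom if all its instances are true in $\mathcal{M}$ under all assignments. *)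

(* Defs.v *)
From mathcomp Require Import all_boot all_order.
From mathcomp Require Import boolp classical_sets.

Set Implicit Arguments.
Unset Strict Implicit.
Unset Printing Implicit Defensive.

Local Open Scope classical_set_scope.

(** * Syntax *)

Record constants := Constants {
  constant :> Type;
  cbot : constant;
  ctop : constant
}.

Inductive formula (V : Type) (C : constants) : Type :=
| Var of V
| Const of C
| Neg of formula V C
| Imp of formula V C & formula V C
| Or of formula V C & formula V C
| And of formula V C & formula V C
| Ident of formula V C & formula V C
| Box of formula V C
| Forall of V & formula V C.

Arguments Var {V C}.
Arguments Const {V C}.
Arguments Forall {V C}.

Section Syntax.
Variables (V : eqType) (C : constants).
Implicit Types (x z : V) (phi psi : formula V C).

Fixpoint free z phi : bool :=
  match phi with
  | Var x => z == x
  | Const _ => false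
  | Neg phi | Box phi => free z phi
  | Imp phi psi | Or phi psi | And phi psi | Ident phi psi =>
      free z phi || free z psi
  | Forall x phi => (z != x) && free z phi
  end.

Definition sentence phi : Prop := forall z, ~~ free z phi.

Definition Iff phi psi := And (Imp phi psi) (Imp psi phi).

Definition collapse phi psi := Imp (And (Box phi) (Box psi)) (Ident phi psi).

Definition strict_equivalence_is_identity x y : formula V C :=
  Forall x (Forall y
    (Iff (Ident (Var x) (Var y))
         (And (Box (Imp (Var x) (Var y))) (Box (Imp (Var y) (Var x)))))).

End Syntax.

(** * Boolean algebras and Boolean prealgebras *)

Record bool_ops (T : Type) := BoolOps {
  op_bot : T;
  op_top : T;
  op_neg : T -> T;
  op_or : T -> T -> T;
  op_and : T -> T -> T;
  op_imp : T -> T -> T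
}.

Definition preserves_bool_ops (T : Type) (S : bool_ops T) (d : Order.disp_t)
    (B : ctbDistrLatticeType d) (p : T -> B) : Prop :=
  [/\ p (op_bot S) = \bot%O /\ p (op_top S) = \top%O,
      forall a, p (op_neg S a) = (~` p a)%O,
      forall a b, p (op_or S a b) = (p a `|` p b)%O,
      forall a b, p (op_and S a b) = (p a `&` p b)%O &
      forall a b, p (op_imp S a b) = (~` p a `|` p b)%O].

(* [c] is a Boolean algebra structure on the type [T] itself; its order is the
   lattice order of the operations [S]. *)
Definition is_boolean_algebra (T : Type) (S : bool_ops T) : Prop :=
  exists (d : Order.disp_t) (c : Order.CTBDistrLattice d T),
    @preserves_bool_ops T S d (Order.CTBDistrLattice.Pack c) (fun a => a).

Section Prealgebra.
Variables (T : Type) (S : bool_ops T) (le : T -> T -> Prop).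

Definition approx a b : Prop := le a b /\ le b a.

Definition quotient : Type :=
  {A : set T | exists a, A = [set b | approx a b]}.

Definition class_of (a : T) : quotient :=
  exist _ [set b | approx a b] (ex_intro _ a erefl).

Definition approx_congruence : Prop :=
  [/\ forall a a', approx a a' -> approx (op_neg S a) (op_neg S a'),
      forall a a' b b', approx a a' -> approx b b' ->
        approx (op_or S a b) (op_or S a' b'),
      forall a a' b b', approx a a' -> approx b b' ->
        approx (op_and S a b) (op_and S a' b') &
      forall a a' b b', approx a a' -> approx b b' ->
        approx (op_imp S a b) (op_imp S a' b')].

Definition is_boolean_prealgebra : Prop :=
  [/\ Relation_Definitions.preorder T le,
      approx_congruence &
      exists (d : Order.disp_t) (c : Order.CTBDistrLattice d quotient),
        let B := Order.CTBDistrLattice.Pack c in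
        @preserves_bool_ops T S d B class_of /\
        forall a b, le a b <-> ((class_of a : B) <= class_of b)%O].

End Prealgebra.

(** * Propositional domains *)

Record domain (C : constants) := Domain {
  carrier :> Type;
  TRUE : set carrier;
  NEC : set carrier;
  f_bot : carrier;
  f_top : carrier;
  f_box : carrier -> carrier;
  f_neg : carrier -> carrier;
  f_or : carrier -> carrier -> carrier;
  f_and : carrier -> carrier -> carrier;
  f_imp : carrier -> carrier -> carrier;
  f_ident : carrier -> carrier -> carrier;
  f_forall : (carrier -> carrier) -> carrier;
  Gamma : C -> carrier;
  Gamma_bot : Gamma (cbot C) = f_bot;
  Gamma_top : Gamma (ctop C) = f_top
}.

Arguments TRUE {C}.
Arguments NEC {C}.
Arguments f_bot {C}.
Arguments f_top {C}.

Definition domain_ops (C : constants) (M : domain C) : bool_ops M :=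
  BoolOps (f_bot M) (f_top M) (@f_neg C M) (@f_or C M) (@f_and C M)
          (@f_imp C M).

Definition domain_le (C : constants) (M : domain C) (a b : M) : Prop :=
  NEC M (f_imp a b).

Section Semantics.
Variables (V : eqType) (C : constants) (M : domain C).
Implicit Types (phi psi : formula V C) (x : V) (gamma : V -> M) (t : M -> M).

Fixpoint denotation gamma phi : M :=
  match phi with
  | Var x => gamma x
  | Const c => Gamma M c
  | Neg phi => f_neg (denotation gamma phi)
  | Imp phi psi => f_imp (denotation gamma phi) (denotation gamma psi)
  | Or phi psi => f_or (denotation gamma phi) (denotation gamma psi)
  | And phi psi => f_and (denotation gamma phi) (denotation gamma psi)
  | Ident phi psi => f_ident (denotation gamma phi) (denotation gamma psi)
  | Box phi => f_box (denotation gamma phi)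
  | Forall x phi =>
      f_forall (fun m => denotation [eta gamma with x |-> m] phi)
  end.

Definition satisfies gamma phi : Prop := TRUE M (denotation gamma phi).

Definition valid phi : Prop := forall gamma, satisfies gamma phi.

Definition definable_by phi x gamma t : Prop :=
  forall m, t m = denotation [eta gamma with x |-> m] phi.

End Semantics.

Definition definable (V : eqType) (C : constants) (M : domain C)
    (t : M -> M) : Prop :=
  exists (phi : formula V C) (x : V) (gamma : V -> M),
    definable_by phi x gamma t.

Definition sentence_denotation (V : eqType) (C : constants) (M : domain C)
    (b : M) : Prop :=
  exists (chi : formula V C) (gamma : V -> M),
    sentence chi /\ denotation gamma chi = b.

(** * Models *)

Section Models.
Variables (V : eqType) (C : constants) (M : domain C).

Local Notation "a <=M b" := (@domain_le C M a b) (at level 70).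
Local Notation "a ~~M b" := (approx (@domain_le C M) a b) (at level 70).

Record truth_conditions : Prop := TruthConditions {
  true_bot : ~ TRUE M (f_bot M);
  true_top : TRUE M (f_top M);
  true_imp : forall a b : M,
    TRUE M (f_imp a b) <-> ~ TRUE M a \/ TRUE M b;
  true_neg : forall a : M, TRUE M (f_neg a) <-> ~ TRUE M a;
  true_and : forall a b : M, TRUE M (f_and a b) <-> TRUE M a /\ TRUE M b;
  true_or : forall a b : M, TRUE M (f_or a b) <-> TRUE M a \/ TRUE M b;
  true_box : forall a : M, TRUE M (f_box a) <-> NEC M a;
  true_ident : forall a b : M, TRUE M (f_ident a b) <-> a = b;
  true_forall : forall t : M -> M, definable V t ->
    (forall a, TRUE M (t a)) -> TRUE M (f_forall t)
}.

Record nec_conditions : Prop := NecConditions {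
  nec_true : NEC M `<=` TRUE M;
  nec_up : forall a b : M, NEC M a -> a <=M b -> NEC M b;
  nec_and : forall a b : M, NEC M a -> NEC M b -> NEC M (f_and a b)
}.

Record modal_conditions : Prop := ModalConditions {
  ident_refl : forall a : M, f_top M <=M f_ident a a;
  ident_imp : forall a b : M, f_ident a b <=M f_imp a b;
  ident_subst : forall (a b : M) (t : M -> M), definable V t ->
    f_ident a b <=M f_ident (t a) (t b);
  box_le : forall a : M, f_box a <=M a;
  box_imp : forall a b : M,
    f_box (f_imp a b) <=M f_imp (f_box a) (f_box b);
  box_imp_box : forall a b : M,
    f_box (f_imp a b) <=M f_box (f_imp (f_box a) (f_box b));
  forall_ident : forall (phi psi : formula V C) x (gamma : V -> M) t1 t2,
    definable_by phi x gamma t1 -> definable_by psi x gamma t2 ->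
    f_forall (fun a => f_ident (t1 a) (t2 a))
      <=M f_ident (f_forall t1) (f_forall t2);
  forall_imp : forall (phi psi : formula V C) x (gamma : V -> M) t1 t2,
    definable_by phi x gamma t1 -> definable_by psi x gamma t2 ->
    f_forall (fun a => f_imp (t1 a) (t2 a))
      <=M f_imp (f_forall t1) (f_forall t2);
  forall_inst : forall (t : M -> M) (a : M), definable V t ->
    f_forall t <=M t a;
  forall_sentence : forall (psi : formula V C) x (gamma : V -> M) t' (b : M),
    definable_by psi x gamma t' -> sentence_denotation V b ->
    f_forall (fun a => f_imp b (t' a)) <=M f_imp b (f_forall t');
  barcan : forall t : M -> M, definable V t ->
    f_box (f_forall t) ~~M f_forall (fun a => f_box (t a));
  nec_forall : forall t : M -> M, definable V t ->
    (forall a, NEC M (t a)) -> NEC M (f_forall t)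
}.

Definition normal : Prop := NEC M !=set0.

Record S3_model : Prop := S3Model {
  model_prealgebra : NEC M !=set0 ->
    is_boolean_prealgebra (domain_ops M) (@domain_le C M);
  model_truth : truth_conditions;
  model_nec : NEC M !=set0 -> nec_conditions;
  model_modal : NEC M !=set0 -> modal_conditions
}.

Definition satisfies_collapse : Prop :=
  forall phi psi : formula V C, valid M (collapse phi psi).

End Models.

(* Main.v *)
Require Import Defs.
From HB Require Import structures.
From mathcomp Require Import all_boot all_order.
From mathcomp Require Import boolp classical_sets.

Set Implicit Arguments.
Unset Strict Implicit.
Unset Printing Implicit Defensive.

Import Order.Theory.

Local Open Scope classical_set_scope.

(** The hub is antisymmetry of [a <= b := NEC (a -> b)].  Validity of (iv) says
    exactly that mutual strict implication is equality.  Antisymmetry makes the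
    projection onto the quotient Boolean algebra injective, so the Boolean
    algebra structure pulls back to the model; it also identifies every
    necessary proposition with top, since [NEC] is the class of top.
    Conversely, in a Boolean algebra whose only necessary element is top,
    [a <= b] means [a -> b = top], which is the lattice order.  The collapse
    axiom applied to a variable and the constant top gives [NEC = {top}]. *)

Section Pullback.
Context {T : Type} {S : bool_ops T} {d : Order.disp_t}.
Context {B : ctbDistrLatticeType d} {p : T -> B}.

(* The hypotheses are phantom arguments of the alias, so that instances on it
   can depend on them. *)
Definition pullback (p_inj : injective p) (pS : preserves_bool_ops S p) := T.

Hypotheses (p_inj : injective p) (pS : preserves_bool_ops S p).
Local Notation PT := (pullback p_inj pS).

HB.instance Definition _ := gen_eqMixin PT.
HB.instance Definition _ := gen_choiceMixin PT.

Let p_bot : p (op_bot S) = \bot%O. Proof. by case: pS => -[]. Qed.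
Let p_top : p (op_top S) = \top%O. Proof. by case: pS => -[]. Qed.
Let p_neg a : p (op_neg S a) = (~` p a)%O. Proof. by case: pS. Qed.
Let p_or a b : p (op_or S a b) = (p a `|` p b)%O. Proof. by case: pS. Qed.
Let p_and a b : p (op_and S a b) = (p a `&` p b)%O. Proof. by case: pS. Qed.
Let p_imp a b : p (op_imp S a b) = (~` p a `|` p b)%O. Proof. by case: pS. Qed.

Let pullback_le : rel PT := fun a b => (p a <= p b)%O.
Let pullback_lt : rel PT := fun a b => (b != a) && pullback_le a b.
Let pullback_meet : PT -> PT -> PT := op_and S.
Let pullback_join : PT -> PT -> PT := op_or S.

(** In [B] the order is the equation [p a] meet [p b] = [p a] between images of [p], so injectivity
    reflects it. The lattice laws below descend from [B] in the same way. *)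
Fact pullback_le_def a b : pullback_le a b = (pullback_meet a b == a).
Proof.
by rewrite /pullback_le leEmeet -p_and; apply/eqP/eqP => [/p_inj|/(congr1 p)].
Qed.

Fact pullback_meetC : commutative pullback_meet.
Proof. by move=> a b; apply: p_inj; rewrite !p_and meetC. Qed.

Fact pullback_joinC : commutative pullback_join.
Proof. by move=> a b; apply: p_inj; rewrite !p_or joinC. Qed.

Fact pullback_meetA : associative pullback_meet.
Proof. by move=> a b c; apply: p_inj; rewrite !p_and meetA. Qed.

Fact pullback_joinA : associative pullback_join.
Proof. by move=> a b c; apply: p_inj; rewrite !p_or joinA. Qed.

Fact pullback_joinKI b a : pullback_meet a (pullback_join a b) = a.
Proof. by apply: p_inj; rewrite p_and p_or joinKI. Qed.

Fact pullback_meetKU b a : pullback_join a (pullback_meet a b) = a.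
Proof. by apply: p_inj; rewrite p_or p_and meetKU. Qed.

Fact pullback_meetUl : left_distributive pullback_meet pullback_join.
Proof.
by move=> a b c; apply: p_inj; rewrite !(p_or, p_and) meetUl.
Qed.

Fact pullback_meetxx : idempotent_op pullback_meet.
Proof. by move=> a; apply: p_inj; rewrite p_and meetxx. Qed.

HB.instance Definition _ := @Order.isMeetJoinDistrLattice.Build d PT
  pullback_le pullback_lt pullback_meet pullback_join
  pullback_le_def (fun _ _ => erefl) pullback_meetC pullback_joinC
  pullback_meetA pullback_joinA pullback_joinKI pullback_meetKU
  pullback_meetUl pullback_meetxx.

Fact pullback_le0x (a : PT) : ((op_bot S : PT) <= a)%O.
Proof. by rewrite /Order.le /= /pullback_le p_bot le0x. Qed.

Fact pullback_lex1 (a : PT) : (a <= (op_top S : PT))%O.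
Proof. by rewrite /Order.le /= /pullback_le p_top lex1. Qed.

HB.instance Definition _ := @Order.hasBottom.Build d PT _ pullback_le0x.
HB.instance Definition _ := @Order.hasTop.Build d PT _ pullback_lex1.

Fact pullback_joinxC (a : PT) : (a `|` (op_neg S a : PT))%O = \top%O.
Proof. by apply: p_inj; rewrite p_or p_neg p_top joinxC. Qed.

Fact pullback_meetxC (a : PT) : (a `&` (op_neg S a : PT))%O = \bot%O.
Proof. by apply: p_inj; rewrite p_and p_neg p_bot meetxC. Qed.

HB.instance Definition _ := @Order.TBDistrLattice_hasComplement.Build d PT
  (op_neg S) pullback_joinxC pullback_meetxC.

Lemma is_boolean_algebra_pullback : is_boolean_algebra S.
Proof.
exists d, (Order.CTBDistrLattice.class PT); split=> // a b.
(* The other clauses hold by conversion; implication is not part of the lattice structure, so its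
   law is reflected from [B]. *)
by apply: p_inj; rewrite p_imp p_or p_neg.
Qed.

End Pullback.

(** By reflexivity [b] lies in its own class, hence in that of [a]; antisymmetry then merges the
    two. *)
Lemma class_of_inj (T : Type) (le : T -> T -> Prop) :
  Relation_Definitions.preorder T le ->
  Relation_Definitions.antisymmetric T le -> injective (class_of le).
Proof.
move=> [le_refl _] le_anti a b /(congr1 sval) /= ab.
have : [set c | approx le a c] b by rewrite ab; split; apply: le_refl.
by case; apply: le_anti.
Qed.

Lemma boolean_algebra_imp_anti (T : Type) (S : bool_ops T) (a b : T) :
  is_boolean_algebra S ->
  op_imp S a b = op_top S -> op_imp S b a = op_top S -> a = b.
Proof.
move=> [d [c [[_ top] _ _ _ imp]]].
set B := Order.CTBDistrLattice.Pack c in top imp *.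
have le u v : op_imp S u v = op_top S -> ((u : B) <= v)%O.
  (* Expand [u] as its meet with top, that is with [~u] join [v]; distributivity leaves [u] meet
     [v]. *)
  move=> uv; rewrite leEmeet -{2}(meetx1 (u : B)) -top -uv imp.
  by rewrite meetUr meetxC join0x.
by move=> /le ab /le ba; apply: (@le_anti d B); rewrite ab ba.
Qed.

Section NormalModels.
Context {V : eqType} {C : constants} {M : domain C}.
Hypotheses (M_model : S3_model V M) (M_normal : normal M).

Let pre := model_prealgebra M_model M_normal.
Let tr := model_truth M_model.
Let nec := model_nec M_model M_normal.
Let modal := model_modal M_model M_normal.

Lemma domain_le_top (a : M) : domain_le a (f_top M).
Proof.
have [_ _ [d [c [[[_ top] _ _ _ _] leE]]]] := pre.
by apply/leE; rewrite top lex1.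
Qed.

Lemma nec_top : NEC M (f_top M).
Proof. by have [a aN] := M_normal; apply: (nec_up nec aN); apply: domain_le_top. Qed.

Lemma nec_top_le (a : M) : NEC M a -> domain_le (f_top M) a.
Proof.
move=> aN; have [_ _ [d [c [[_ _ _ _ imp] leE]]]] := pre.
(* The goal unfolds to necessity of top -> [a], which lies above the necessary [a]. *)
apply: (nec_up nec aN); apply/leE.
by rewrite imp leUr.
Qed.

Lemma nec_eq_top : Relation_Definitions.antisymmetric M (@domain_le C M) ->
  NEC M = [set f_top M].
Proof.
move=> anti; apply/seteqP; split=> [a aN|_ ->]; last exact: nec_top.
by apply: anti; [apply: domain_le_top|apply: nec_top_le].
Qed.

Lemma antisymmetric_boolean_algebra :
  Relation_Definitions.antisymmetric M (@domain_le C M) ->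
  is_boolean_algebra (domain_ops M).
Proof.
move=> anti; have [preo _ [d [c [hom _]]]] := pre.
by apply: is_boolean_algebra_pullback hom; apply: class_of_inj.
Qed.

(** The truth conditions give only the direction from instances to the quantifier; the converse
    comes from [forall_inst], since a necessary implication is true. *)
Lemma true_forallP x (phi : formula V C) (gamma : V -> M) :
  satisfies gamma (Forall x phi) <->
  forall m, satisfies [eta gamma with x |-> m] phi.
Proof.
pose t m := denotation [eta gamma with x |-> m] phi.
have t_def : definable V t by exists phi, x, gamma.
split=> [all m|all]; last exact: (true_forall tr t_def all).
have /(nec_true nec) := forall_inst modal m t_def.
by case/(true_imp tr).
Qed.

(** The formula is closed, so one assignment decides it. Distinctness of [x] and [y] keeps the value
    of [x] through the inner update. *)
Lemma satisfies_strict_equivalence (x y : V) (gamma : V -> M) : x != y ->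
  satisfies gamma (strict_equivalence_is_identity C x y) <->
  forall a b : M, a = b <-> approx (@domain_le C M) a b.
Proof.
move=> xy.
have body a b : satisfies [eta [eta gamma with x |-> a] with y |-> b]
    (Iff (Ident (Var x) (Var y))
         (And (Box (Imp (Var x) (Var y))) (Box (Imp (Var y) (Var x))))) <->
    (a = b <-> approx (@domain_le C M) a b).
  rewrite /satisfies /= !eqxx (negbTE xy).
  rewrite (true_and tr) !(true_imp tr) !(true_and tr) !(true_box tr).
  by rewrite (true_ident tr) -!implyE.
split=> [/true_forallP all a b|all].
  by apply/body; move/true_forallP: (all a).
by apply/true_forallP => a; apply/true_forallP => b; apply/body.
Qed.

End NormalModels.

Theorem theorem30 (V : eqType) (C : constants) (x y : V) (x_neq_y : x != y)
    (M : domain C) (M_model : S3_model V M) (M_normal : normal M) :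
  [<-> is_boolean_algebra (domain_ops M) /\ satisfies_collapse V M;
       is_boolean_algebra (domain_ops M) /\ NEC M = [set f_top M];
       Relation_Definitions.order M (@domain_le C M);
       valid M (strict_equivalence_is_identity C x y)].
Proof.
have tr := model_truth M_model.
have [[le_refl le_trans] _ _] := model_prealgebra M_model M_normal.
tfae.
- move=> [BA col]; split=> //; apply/seteqP; split=> [a aN|_ ->]; last first.
    exact: (nec_top M_model).
  (* The constant assignment lets [Var x] denote an arbitrary necessary [a]. *)
  have /(true_imp tr) := col (Var x) (Const (ctop C)) (fun=> a).
  rewrite /= Gamma_top (true_and tr) !(true_box tr) (true_ident tr).
  by case=> // -[]; split=> //; apply: (nec_top M_model).
- move=> [BA necE]; split=> // a b; rewrite /domain_le necE /=.
  exact: (@boolean_algebra_imp_anti M (domain_ops M)).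
- move=> [_ _ anti] gamma; apply/(satisfies_strict_equivalence M_model) => // a b.
  by split=> [->|[]]; [split; apply: le_refl|apply: anti].
- move=> val.
  have anti : Relation_Definitions.antisymmetric M (@domain_le C M).
    move=> a b ab ba.
    (* Any assignment would do here; [a] supplies one. *)
    have /(satisfies_strict_equivalence M_model) E := val (fun=> a).
    by apply/E.
  split=> [|phi psi gamma]; first exact: (antisymmetric_boolean_algebra M_model).
  apply/(true_imp tr); rewrite /= (true_and tr) !(true_box tr) (true_ident tr).
  (* Two necessary propositions are both top, hence equal. *)
  rewrite (nec_eq_top M_model M_normal anti) -implyE.
  by move=> [-> ->].
Qed.
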